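(* Let $r\in\mathbb{N}$ and $f_0,f_1,\ldots,f_r\in\mathcal{Y}^{1}([a,b],\mathbb{R})$. If $$\int_a^b\left(\sum_{i=0}^{r}f_i(t)\,D_{q,\omega}^{i}\big[\eta^{\sigma^{r-i}}\big](t)\right)d_{q,\omega}t=0$$ for any variation $\eta$ (i.e. any $\eta\in\mathcal{Y}^{r}([a,b],\mathbb{R})$ with $D^i_{q,\omega}[\eta](a)=D^i_{q,\omega}[\eta](b)=0$ for $i=0,\ldots,r-1$), then $$\sum_{i=0}^{r}(-1)^{i}\left(\frac1q\right)^{\frac{(i-1)i}{2}}D_{q,\omega}^{i}[f_i](t)=0$$ for all $t\in[a,b]_{q,\omega}$.
   Context: Fix real numbers $q\in(0,1)$ and $\omega>0$, put $\omega_0:=\frac{\omega}{1-q}$, and let $I\subseteq\mathbb{R}$ be an interval containing $\omega_0$. Let $\sigma(t):=qt+\omega$; then $\sigma(I)\subseteq I$ and $\sigma(\omega_0)=\omega_0$. For $n\in\mathbb{N}_0=\mathbb{N}\cup\{0\}$ let $[n]_q:=\frac{1-q^n}{1-q}$, so the $n$-fold composition is $\sigma^n(t)=q^nt+\omega[n]_q$. Hahn difference operator: for $f:I\to\mathbb{R}$, $D_{q,\omega}[f](t):=\frac{f(qt+\omega)-f(t)}{(q-1)t+\omega}$ if $t\neq\omega_0$, and $D_{q,\omega}[f](\omega_0):=f'(\omega_0)$ (ordinary derivative), provided $f$ is differentiable at $\omega_0$; $f$ is called $q,\omega$-differentiable on $I$ if $D_{q,\omega}[f](\omega_0)$ exists.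 Higher order: $D^0_{q,\omega}[f]:=f$ and $D^k_{q,\omega}[f]:=D_{q,\omega}[D^{k-1}_{q,\omega}[f]]$ for $k\in\mathbb{N}$, provided $D^{k-1}_{q,\omega}[f]$ is $q,\omega$-differentiable on $I$. Notation: $y^{\sigma^k}:=y\circ\sigma^k$ ($k\ge 0$, with $y^{\sigma^0}=y$ and $y^\sigma=y^{\sigma^1}$). $q,\omega$-integral: for $x\in I$, $\int_{\omega_0}^{x}f(t)\,d_{q,\omega}t:=(x(1-q)-\omega)\sum_{k=0}^{\infty}q^kf(xq^k+\omega[k]_q)$ when the series converges, and $\int_a^bf(t)\,d_{q,\omega}t:=\int_{\omega_0}^bf(t)\,d_{q,\omega}t-\int_{\omega_0}^af(t)\,d_{q,\omega}t$. Let $a,b\in I$ with $a<b$. Set $[a,b]_{q,\omega}:=\{q^na+\omega[n]_q:n\in\mathbb{N}_0\}\cup\{q^nb+\omega[n]_q:n\in\mathbb{N}_0\}\cup\{\omega_0\}$. For $k\in\mathbb{N}$, $\mathcal{Y}^{k}([a,b],\mathbb{R})$ is the linear space of functions $y:I\to\mathbb{R}$ such that $D^i_{q,\omega}[y]$, $i=0,\ldots,k$, (exist and) are bounded on $[a,b]$ and continuous at $\omega_0$.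
   Formalization: It is assumed that the orbits {σⁿ(a)} and {σⁿ(b)} are disjoint (automatic if a ≤ ω₀ ≤ b; if one endpoint lies on the other's orbit, the claim is false), and, at t = ω₀, that the derivatives D^i[f_i](ω₀) exist. *)

(* Defs.v *)
From HB Require Import structures.
From mathcomp Require Import all_boot all_order all_algebra.
From mathcomp Require Import all_classical all_reals all_analysis.
Set Implicit Arguments.
Unset Strict Implicit.
Unset Printing Implicit Defensive.
Import Order.TTheory GRing.Theory Num.Theory.
Import numFieldNormedType.Exports.
Local Open Scope classical_set_scope.
Local Open Scope ring_scope.

(* A function y : I -> R on an interval I is represented by y : R -> R; every
   notion below looks at y only at points of I (hsigma maps I into itself), and
   limits at omega0 are taken within I, so that they are one-sided when omega0
   is an endpoint of I and the usual ones when omega0 is interior to I. *)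

Definition diff_quotient (R : realType) (f : R -> R) (x t : R) : R :=
  (f t - f x) / (t - x).

Definition derivable_within (R : realType) (I : set R) (f : R -> R) (x : R)
    : Prop :=
  cvg (diff_quotient f x t @[t --> within I x^']).

Definition derive_within (R : realType) (I : set R) (f : R -> R) (x : R) : R :=
  lim (diff_quotient f x t @[t --> within I x^']).

Definition continuous_within_at (R : realType) (I : set R) (f : R -> R) (x : R)
    : Prop :=
  f t @[t --> within I (nbhs x)] --> f x.

Definition omega0 (R : realType) (q w : R) : R := w / (1 - q).

Definition hsigma (R : realType) (q w t : R) : R := q * t + w.

Definition qnum (R : realType) (q : R) (n : nat) : R := (1 - q ^+ n) / (1 - q).

Definition hahnD (R : realType) (q w : R) (I : set R) (f : R -> R) : R -> R :=
  fun t => if t == omega0 q w then derive_within I f (omega0 q w)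
           else (f (q * t + w) - f t) / ((q - 1) * t + w).

Definition hahnDn (R : realType) (q w : R) (I : set R) (k : nat) (f : R -> R)
    : R -> R :=
  iter k (hahnD q w I) f.

(* Existence of D^k[f]: hahnDn is a total function, and its value at omega0 is
   meaningful only under this condition. *)
Definition hahn_differentiable (R : realType) (q w : R) (I : set R) (k : nat)
    (f : R -> R) : Prop :=
  forall j, (j < k)%N -> derivable_within I (hahnDn q w I j f) (omega0 q w).

(* D^k[f](t) has a meaning: at t <> omega0 the iterated difference quotients
   only involve values of f at the points sigma^j(t), all distinct from omega0,
   so that no derivative enters. *)
Definition hahnDn_defined_at (R : realType) (q w : R) (I : set R) (k : nat)
    (f : R -> R) (t : R) : Prop :=
  t = omega0 q w -> hahn_differentiable q w I k f.

Definition hahn_series (R : realType) (q w : R) (f : R -> R) (x : R) : R^nat :=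
  series (fun k : nat => q ^+ k * f (x * q ^+ k + w * qnum q k)).

Definition hahn_integral0 (R : realType) (q w : R) (f : R -> R) (x : R) : R :=
  (x * (1 - q) - w) * limn (hahn_series q w f x).

Definition hahn_integrable (R : realType) (q w a b : R) (f : R -> R) : Prop :=
  cvgn (hahn_series q w f a) /\ cvgn (hahn_series q w f b).

Definition hahn_integral (R : realType) (q w a b : R) (f : R -> R) : R :=
  hahn_integral0 q w f b - hahn_integral0 q w f a.

Definition hahn_orbit (R : realType) (q w x : R) : set R :=
  [set q ^+ n * x + w * qnum q n | n in [set: nat]].

Definition hahn_interval (R : realType) (q w a b : R) : set R :=
  hahn_orbit q w a `|` hahn_orbit q w b `|` [set omega0 q w].

Definition hahn_space (R : realType) (q w : R) (I : set R) (a b : R) (k : nat)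
    (y : R -> R) : Prop :=
  hahn_differentiable q w I k y /\
  forall i, (i <= k)%N ->
    [bounded hahnDn q w I i y t | t in `[a, b]] /\
    continuous_within_at I (hahnDn q w I i y) (omega0 q w).

Definition hahn_variation (R : realType) (q w : R) (I : set R) (a b : R)
    (r : nat) (eta : R -> R) : Prop :=
  hahn_space q w I a b r eta /\
  forall i, (i < r)%N -> hahnDn q w I i eta a = 0 /\ hahnDn q w I i eta b = 0.

(* Main.v *)
Require Import Defs.
From HB Require Import structures.
From mathcomp Require Import all_boot all_order all_algebra.
From mathcomp Require Import all_classical all_reals all_analysis.
From mathcomp Require Import ring lra.
Set Implicit Arguments.
Unset Strict Implicit.
Unset Printing Implicit Defensive.
Import Order.TTheory GRing.Theory Num.Theory.
Import numFieldNormedType.Exports.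
Local Open Scope classical_set_scope.
Local Open Scope ring_scope.

(** Centred at the fixed point omega0 of sigma, the map sigma is t |-> q t, so
    away from omega0 everything happens on single orbits x_n = sigma^n(x): there
    D is a weighted forward difference and the integral from omega0 to x is
    (x (1 - q) - w) times the weighted sum of q^n g(x_n).  This makes the
    fundamental lemma of the calculus of variations available in its crudest
    form, with point masses as test functions.

    A point mass eta at x_(p+r), where x is a or b and x <> omega0, vanishes
    near omega0, hence so do all its Hahn derivatives, which are moreover bounded
    (bounded_null_near_hahnD).  At an endpoint other than omega0, D^i[eta]
    reads eta at the first i + 1 orbit points only, so eta is a variation.  Its translate eta o sigma^(r-i) is differentiated
    i times in the integrand, and r-i steps plus i summations by parts always
    add up to r: each D moved from eta to f_i costs a sign, a shift of eta by
    one step, and the factor 1/q^k produced by pulling sigma out of D^k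
    (hahnDn_comp_hsigma).  The factors multiply to (1/q)^(i(i-1)/2), see
    sum_by_parts_orbit_iter, and every term of the integral becomes a sum
    against eta(x_(n+r)), in which the point mass selects n = p.  The orbit of
    the other endpoint contributes nothing because the two orbits are disjoint.
    So the Euler expression vanishes at x_p for every p.

    At omega0 itself, the Euler expression is the limit of its values along an
    orbit: f_0 is continuous there, and for i > 0 differentiability of
    h = D^(i-1)[f_i] at omega0 forces D[h](x_n) to tend to h'(omega0)
    (cvg_hahnD_orbit). *)

Section HahnCalculus.
Variables (R : realType) (q w : R) (I : set R).
Hypotheses (q_gt0 : 0 < q) (q_lt1 : q < 1).

Local Notation sigma := (hsigma q w).
Local Notation om := (omega0 q w).
Local Notation D := (hahnDn q w I).
Local Notation orb x n := (iter n (hsigma q w) x).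

(** * The orbits of sigma *)

Let q_neq0 : q != 0. Proof. by rewrite gt_eqF. Qed.
Let q1_neq0 : q - 1 != 0. Proof. by rewrite subr_eq0 lt_eqF. Qed.
Let onemq_neq0 : 1 - q != 0. Proof. by rewrite subr_eq0 gt_eqF. Qed.

Lemma hsigma_sub_omega0 t : sigma t - om = q * (t - om).
Proof. by rewrite /hsigma /omega0; field. Qed.

Lemma hsigma_eq_omega0 t : (sigma t == om) = (t == om).
Proof.
by rewrite -subr_eq0 hsigma_sub_omega0 mulf_eq0 (negbTE q_neq0) subr_eq0.
Qed.

Lemma iter_hsigma_sub_omega0 n t : orb t n - om = q ^+ n * (t - om).
Proof.
elim: n => [|n IH]; first by rewrite expr0 mul1r.
by rewrite iterS hsigma_sub_omega0 IH exprS mulrA.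
Qed.

Lemma iter_hsigma_eq_omega0 n t : (orb t n == om) = (t == om).
Proof. by elim: n => // n IH; rewrite iterS hsigma_eq_omega0. Qed.

Lemma iter_hsigmaE n t : orb t n = q ^+ n * t + w * qnum q n.
Proof.
apply/eqP; rewrite -(inj_eq (addIr (- om))) iter_hsigma_sub_omega0; apply/eqP.
by rewrite /qnum /omega0; field.
Qed.

Lemma iter_hsigma_inj t : t != om -> injective (fun n => orb t n).
Proof.
move=> tom m n /eqP; rewrite -(inj_eq (addIr (- om))) !iter_hsigma_sub_omega0.
rewrite (inj_eq (mulIf _)) ?subr_eq0 // => /eqP.
by apply: ieexprIn => //; rewrite lt_eqF.
Qed.

Lemma hahn_weightE x : x * (1 - q) - w = (1 - q) * (x - om).
Proof. by rewrite /omega0; field. Qed.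

Lemma iter_hsigma_mem x n : is_interval I -> I om -> I x -> I (orb x n).
Proof.
move=> Iitv Iom Ix; elim: n => // n; rewrite iterS.
move: (orb x n) => t It; have := hsigma_sub_omega0 t.
move: (sigma t) om Iom => s o Io st.
have [tom|tom] := leP t o.
  have := mulr_ge0 (ltW q_gt0) (_ : 0 <= o - t); rewrite subr_ge0 => /(_ tom).
  have := mulr_ge0 (_ : 0 <= 1 - q) (_ : 0 <= o - t).
  rewrite !subr_ge0 (ltW q_lt1) => /(_ isT tom) h1 h2.
  by apply: (Iitv _ _ It Io); apply/andP; split; lra.
have := mulr_ge0 (ltW q_gt0) (_ : 0 <= t - o); rewrite subr_ge0 ltW // => /(_ isT).
have := mulr_ge0 (_ : 0 <= 1 - q) (_ : 0 <= t - o).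
rewrite !subr_ge0 (ltW q_lt1) ltW // => /(_ isT isT) h1 h2.
by apply: (Iitv _ _ Io It); apply/andP; split; lra.
Qed.

Lemma cvg_iter_hsigma {x} : orb x n @[n --> \oo] --> om.
Proof.
suff : (q ^+ n * (x - om) + om) @[n --> \oo] --> om.
  apply: cvg_trans; apply: near_eq_cvg; apply: nearW => n.
  by rewrite -iter_hsigma_sub_omega0 subrK.
rewrite -[X in _ --> X]add0r -[X in _ --> X + _](mul0r (x - om)).
by apply: cvgD;
  [apply: cvgMl; apply: cvg_expr; rewrite gtr0_norm|exact: cvg_cst].
Qed.

Lemma cvg_iter_hsigma_within x : is_interval I -> I om -> I x ->
  orb x n @[n --> \oo] --> within I (nbhs om).
Proof.
move=> Iitv Iom Ix P nP.
have : \forall n \near \oo, I (orb x n) -> P (orb x n).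
  exact: (cvg_iter_hsigma (x := x) nP).
by apply: filterS => n; apply; exact: iter_hsigma_mem.
Qed.

Lemma cvg_iter_hsigma_dwithin x : is_interval I -> I om -> I x -> x != om ->
  orb x n @[n --> \oo] --> within I om^'.
Proof.
move=> Iitv Iom Ix xom P nP.
have : \forall n \near \oo, orb x n != om -> I (orb x n) -> P (orb x n).
  exact: (cvg_iter_hsigma (x := x) nP).
apply: filterS => n; apply; last exact: iter_hsigma_mem.
by rewrite iter_hsigma_eq_omega0.
Qed.

(** * Iterated Hahn differences off the fixed point *)

Lemma hahnDE f t : t != om ->
  hahnD q w I f t = (f (sigma t) - f t) / ((q - 1) * (t - om)).
Proof.
move=> tom; rewrite /hahnD (negbTE tom); congr (_ / _).
by rewrite /omega0; field.
Qed.

Lemma hahnDnS k f t : t != om ->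
  D k.+1 f t = (D k f (sigma t) - D k f t) / ((q - 1) * (t - om)).
Proof. exact: hahnDE. Qed.

(** The chain rule for the affine map sigma, whose slope is q; it is the source
    of the powers of 1/q in the Euler equation. *)
Lemma hahnDn_comp_hsigma k f t : t != om ->
  D k (f \o sigma) t = q ^+ k * D k f (sigma t).
Proof.
elim: k t => [|k IH] t tom; first by rewrite expr0 mul1r.
have stom : sigma t != om by rewrite hsigma_eq_omega0.
rewrite !hahnDnS // !IH // hsigma_sub_omega0 exprS.
by field; rewrite subr_eq0 tom q_neq0 q1_neq0.
Qed.

(** D^k f(t) is a combination of the values of f at the first k + 1 points of the
    orbit of t. *)
Lemma hahnDn_eq0 k f t : t != om ->
  (forall j, (j <= k)%N -> f (orb t j) = 0) -> D k f t = 0.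
Proof.
elim: k t => [|k IH] t tom f0; first exact: (f0 0%N).
rewrite hahnDnS // !IH ?subrr ?mul0r ?hsigma_eq_omega0 // => j jk.
  by apply: f0; rewrite ltnW.
by rewrite -iterSr; apply: f0.
Qed.

(** * Summation by parts along an orbit *)

(** The weight q^n cancels the denominator (q - 1) (x_n - omega0) up to a
    constant, so the two sums differ by a telescoping sum of the increments of u v. *)
Lemma sum_by_parts_orbit (u v : R -> R) x N : x != om ->
  v x = 0 -> v (orb x N) = 0 ->
  \sum_(n < N) q ^+ n * (u (orb x n) * hahnD q w I v (orb x n)) =
  - \sum_(n < N) q ^+ n * (hahnD q w I u (orb x n) * v (orb x n.+1)).
Proof.
move=> xom vx vN; apply/eqP; rewrite -subr_eq0 opprK -big_split /=.
have c0 : (q - 1) * (x - om) != 0 by rewrite mulf_neq0 // subr_eq0.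
rewrite (eq_bigr (fun n : 'I_N => ((q - 1) * (x - om))^-1 *
  (u (orb x n.+1) * v (orb x n.+1) - u (orb x n) * v (orb x n)))); last first.
  move=> n _; have nom : orb x n != om by rewrite iter_hsigma_eq_omega0.
  rewrite !hahnDE // iter_hsigma_sub_omega0 -iterS.
  by field; rewrite q1_neq0 subr_eq0 xom expf_neq0.
rewrite -mulr_sumr -(big_mkord xpredT (fun n => u (orb x n.+1) * v (orb x n.+1)
  - u (orb x n) * v (orb x n))) /=.
by rewrite (telescope_sumr (fun n => u (orb x n) * v (orb x n))) // vN vx !mulr0
  subrr mulr0.
Qed.

(** Summation by parts, i times.  The step that moves a D off D^(i+1) leaves the
    remaining D^i evaluated one step further along the orbit; rewriting that as a
    D^i of the shifted function costs q^-i, whence the exponent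
    0 + 1 + ... + (i - 1) = 'C(i, 2).  The boundary terms vanish because eta is
    null at the beginning and at the end of the orbit. *)
Lemma sum_by_parts_orbit_iter i k (u eta : R -> R) x N : x != om ->
  (forall j, (j < k + i)%N -> eta (orb x j) = 0) ->
  (forall j, (N <= j)%N -> eta (orb x j) = 0) ->
  \sum_(n < N) q ^+ n *
    (u (orb x n) * D i (eta \o (fun t => orb t k)) (orb x n)) =
  (-1) ^+ i * q^-1 ^+ 'C(i, 2) *
    \sum_(n < N) q ^+ n * (D i u (orb x n) * eta (orb x (n + (k + i)))).
Proof.
move=> xom; elim: i k u => [|i IH] k u eta_lo eta_hi.
  rewrite bin_small // !expr0 !mul1r; apply: eq_bigr => n _.
  by rewrite addn0 /= -iterD addnC.
rewrite sum_by_parts_orbit //; last 2 first.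
- apply: hahnDn_eq0 => // j ji; rewrite /= -iterD; apply: eta_lo.
  by rewrite addnS ltnS leq_add2l.
- apply: hahnDn_eq0 => [|j ji]; first by rewrite iter_hsigma_eq_omega0.
  by rewrite /= -!iterD; apply: eta_hi; rewrite leq_addl.
have -> : \sum_(n < N) q ^+ n * (hahnD q w I u (orb x n) *
      iter i (hahnD q w I) (eta \o (fun t => orb t k)) (orb x n.+1)) =
    q^-1 ^+ i * \sum_(n < N) q ^+ n * (hahnD q w I u (orb x n) *
      D i (eta \o (fun t => orb t k.+1)) (orb x n)).
  rewrite mulr_sumr; apply: eq_bigr => n _.
  have -> : eta \o (fun t => orb t k.+1) = (eta \o (fun t => orb t k)) \o sigma.
    by apply/funext => t /=; rewrite -iterSr.
  rewrite hahnDn_comp_hsigma ?iter_hsigma_eq_omega0 // /hahnDn iterS.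
  by rewrite exprVn; field; rewrite expf_neq0.
rewrite IH //; last by rewrite addSn -addnS.
under [X in - (_ * (_ * X)) = _]eq_bigr do rewrite addSnnS /hahnDn -iterSr.
by rewrite binS bin1 exprD exprS; ring.
Qed.

(** * Point masses as variations *)

(** A class of functions that is stable under D and contained in every space of
    variations up to boundary conditions: the division by t - omega0 in D is
    harmless for a function that is null near omega0. *)
Definition bounded_null_near (f : R -> R) : Prop :=
  exists M e : R, [/\ 0 < e, forall t, `|f t| <= M
    & forall t, `|t - om| < e -> f t = 0].

Section NearOmega0.
(* Without properness, the limit that defines derive_within would not be unique. *)
Hypotheses (I_dnbhs : ProperFilter (within I om^')).

Lemma null_near_derive f e : 0 < e -> (forall t, `|t - om| < e -> f t = 0) ->
  derivable_within I f om /\ derive_within I f om = 0.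
Proof.
move=> e0 f0.
have near0 : \forall t \near within I om^', diff_quotient f om t = 0.
  rewrite near_withinE /dnbhs near_withinE; apply/nbhs_ballP.
  exists e => //= t; rewrite /ball /= distrC => te _ _.
  by rewrite /diff_quotient !f0 ?subrr ?mul0r ?normr0.
by split; [exact: is_cvg_near_cst near0|exact: lim_near_cst near0].
Qed.

(** The same radius e works for D f because sigma contracts towards omega0, and
    outside of it the denominator is at least (1 - q) e. *)
Lemma bounded_null_near_hahnD f :
  bounded_null_near f -> bounded_null_near (hahnD q w I f).
Proof.
move=> [M [e [e0 fM f0]]].
have [_ Df0] := null_near_derive e0 f0.
have Dnear t : `|t - om| < e -> hahnD q w I f t = 0.
  move=> te; have [->|tom] := eqVneq t om; first by rewrite /hahnD eqxx.
  rewrite hahnDE // !f0 ?subrr ?mul0r // hsigma_sub_omega0 normrM gtr0_norm //.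
  by apply: le_lt_trans te; rewrite ler_piMl // ltW.
exists (2 * M / ((1 - q) * e)), e; split=> // t.
have q1 : 0 < 1 - q by rewrite subr_gt0.
have M0 : 0 <= M by apply: le_trans (fM 0).
have [/Dnear ->|te] := ltP `|t - om| e.
  by rewrite normr0 divr_ge0 ?mulr_ge0 // ltW.
have tom : t != om by rewrite -subr_eq0 -normr_gt0 (lt_le_trans e0).
have nq1 : `|q - 1| = 1 - q by rewrite distrC gtr0_norm.
rewrite hahnDE // normrM normfV normrM nq1.
apply: ler_pM => //.
- by rewrite invr_ge0 mulr_ge0 // ltW.
- by apply: le_trans (ler_normB _ _) _; rewrite mulr_natl mulr2n lerD.
- rewrite lef_pV2 ?posrE ?mulr_gt0 //; last exact: lt_le_trans te.
  by rewrite ler_pM2l.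
Qed.

Lemma bounded_null_near_hahnDn k f :
  bounded_null_near f -> bounded_null_near (D k f).
Proof. by move=> nf; elim: k => // k; exact: bounded_null_near_hahnD. Qed.

Lemma hahn_space_null_near a b k f :
  bounded_null_near f -> hahn_space q w I a b k f.
Proof.
move=> nf; split=> [j _|i _]; have := bounded_null_near_hahnDn.
  by move=> /(_ j _ nf)[M [e [e0 _ /(null_near_derive e0)[]]]].
move=> /(_ i _ nf)[M [e [e0 fM f0]]]; split.
  by exists M; split=> [|N MN t _ /=]; [exact: num_real|exact: le_trans (ltW MN)].
apply: cvg_near_cst; rewrite near_withinE; apply/nbhs_ballP.
exists e => //= t; rewrite /ball /= distrC => te _.
by rewrite !f0 ?subrr ?normr0.
Qed.

Lemma hahn_variation_null_near a b r f : bounded_null_near f ->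
  (forall j, (j < r)%N -> f (orb a j) = 0 /\ f (orb b j) = 0) ->
  hahn_variation q w I a b r f.
Proof.
move=> nf f0; split; first exact: hahn_space_null_near.
have D0 x i : (forall j, (j <= i)%N -> f (orb x j) = 0) -> D i f x = 0.
  move=> fx; have [->|] := eqVneq x om; last by move/hahnDn_eq0; exact.
  have [M [e [e0 _ ->]]] // := bounded_null_near_hahnDn i nf.
  by rewrite subrr normr0.
by move=> i ir; split; apply: D0 => j ji; have [] := f0 j (leq_ltn_trans ji ir).
Qed.

End NearOmega0.

Lemma bounded_null_near_pointmass z : z != om ->
  bounded_null_near (fun t => (t == z)%:R).
Proof.
move=> zom; exists 1, `|z - om|; split.
- by rewrite normr_gt0 subr_eq0.
- by move=> t; case: (t == z); rewrite ?normr1 ?normr0.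
- by move=> t tz; case: eqP tz => // ->; rewrite ltxx.
Qed.

(** An orbit that does not start at omega0 accumulates there, inside I. *)
Lemma within_dnbhs_omega0_proper x : is_interval I -> I om -> I x -> x != om ->
  ProperFilter (within I om^').
Proof.
move=> Iitv Iom Ix xom; split; last exact: within_filter.
move=> h; have : \forall n \near \oo, False.
  exact: (cvg_iter_hsigma_dwithin Iitv Iom Ix xom h).
by move=> [N _ /(_ N (leqnn N))].
Qed.

(** * The integral tested against a point mass *)

(** The Euler expression, whose vanishing is to be derived. *)
Definition hahn_euler r (f : 'I_r.+1 -> R -> R) (t : R) : R :=
  \sum_(i < r.+1) (-1) ^+ i * (1 / q) ^+ ((i - 1) * i)./2 * D i (f i) t.

(** The integrand of the first variation in direction eta. *)
Definition hahn_first_variation r (f : 'I_r.+1 -> R -> R) (eta : R -> R) t : R :=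
  \sum_(i < r.+1) f i t * D i (eta \o iter (r - i) sigma) t.

Lemma hahn_seriesE f x N :
  hahn_series q w f x N = \sum_(n < N) q ^+ n * f (orb x n).
Proof.
rewrite /hahn_series seriesEord /=; apply: eq_bigr => n _.
by rewrite iter_hsigmaE [x * _]mulrC.
Qed.

Lemma limn_hahn_series f x N : (forall n, (N <= n)%N -> f (orb x n) = 0) ->
  limn (hahn_series q w f x) = \sum_(n < N) q ^+ n * f (orb x n).
Proof.
move=> f0; apply: lim_near_cst => //; exists N => // n /= Nn.
rewrite hahn_seriesE -(subnKC Nn) big_split_ord /= [X in _ + X]big1 ?addr0 //.
by move=> i _; rewrite f0 ?mulr0 // leq_addr.
Qed.

Lemma hahn_first_variation_eq0 r (f : 'I_r.+1 -> R -> R) eta t : t != om ->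
  (forall n, eta (orb t n) = 0) -> hahn_first_variation f eta t = 0.
Proof.
move=> tom eta0; rewrite /hahn_first_variation big1 // => i _.
by rewrite hahnDn_eq0 ?mulr0 // => j _; rewrite /= -iterD.
Qed.

(** If y = omega0, it is the factor y (1 - q) - w of the integral that vanishes. *)
Lemma hahn_integral0_first_variation_eq0 r (f : 'I_r.+1 -> R -> R) eta y :
  (forall n, eta (orb y n) = 0) ->
  hahn_integral0 q w (hahn_first_variation f eta) y = 0.
Proof.
move=> eta0; rewrite /hahn_integral0; have [->|yom] := eqVneq y om.
  by rewrite /omega0 divfK // subrr mul0r.
rewrite (@limn_hahn_series _ _ 0%N) ?big_ord0 ?mulr0 // => n _.
apply: hahn_first_variation_eq0 => [|m]; first by rewrite iter_hsigma_eq_omega0.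
by rewrite -iterD.
Qed.

(** After the summations by parts every term carries eta(x_(n+r)), which
    isolates n = p. *)
Lemma hahn_integral0_pointmass r (f : 'I_r.+1 -> R -> R) x p : x != om ->
  hahn_integral0 q w
    (hahn_first_variation f (fun t => (t == orb x (p + r))%:R)) x =
  (x * (1 - q) - w) * (q ^+ p * hahn_euler f (orb x p)).
Proof.
move=> xom; set eta := fun t => _; rewrite /hahn_integral0; congr (_ * _).
have etaE n : eta (orb x n) = (n == p + r)%:R.
  by rewrite /eta (inj_eq (iter_hsigma_inj xom)).
have eta_lo j : (j < r)%N -> eta (orb x j) = 0.
  by move=> jr; rewrite etaE ltn_eqF // ltn_addl.
have eta_hi j : (p + r < j)%N -> eta (orb x j) = 0.
  by move=> jr; rewrite etaE gtn_eqF.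
rewrite (@limn_hahn_series _ _ (p + r).+1); last first.
  move=> n pn; apply: hahn_first_variation_eq0 => [|m].
    by rewrite iter_hsigma_eq_omega0.
  by rewrite -iterD eta_hi // ltn_addl.
under eq_bigr do rewrite /hahn_first_variation mulr_sumr.
rewrite exchange_big /hahn_euler mulr_sumr /=; apply: eq_bigr => i _.
have ir : (r - i + i = r)%N by rewrite subnK // -ltnS.
rewrite (@sum_by_parts_orbit_iter i (r - i) (f i) eta) ?ir //.
have lt_p : (p < (p + r).+1)%N by rewrite ltnS leq_addr.
rewrite (bigD1 (Ordinal lt_p)) //= etaE eqxx mulr1 big1 ?addr0; last first.
  move=> n np; rewrite etaE eqn_add2r; case: eqP => [e|]; last by rewrite !mulr0.
  by case/eqP: np; apply: val_inj.
by rewrite bin2 div1r subn1 [(_.-1 * _)%N]mulnC; ring.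
Qed.

(** * Passing to the fixed point *)

(** D[h](t) is the affine combination (q d(sigma t) - d(t)) / (q - 1) of the
    ordinary difference quotients d of h at omega0, both of which converge. *)
Lemma cvg_hahnD_orbit h x : is_interval I -> I om -> I x -> x != om ->
  derivable_within I h om ->
  hahnD q w I h (orb x n) @[n --> \oo] --> hahnD q w I h om.
Proof.
move=> Iitv Iom Ix xom dh.
have d_cvg : diff_quotient h om (orb x n) @[n --> \oo] --> derive_within I h om.
  exact: cvg_comp (cvg_iter_hsigma_dwithin Iitv Iom Ix xom) dh.
have dS_cvg : diff_quotient h om (orb x n.+1) @[n --> \oo]
    --> derive_within I h om.
  by move: d_cvg; rewrite -cvg_shiftS.
have -> : hahnD q w I h om =
    (q * derive_within I h om - derive_within I h om) / (q - 1).
  by rewrite /hahnD eqxx; field.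
have -> : (fun n => hahnD q w I h (orb x n)) = fun n =>
    (q * diff_quotient h om (orb x n.+1) - diff_quotient h om (orb x n)) / (q - 1).
  apply/funext => n; have nom : orb x n != om by rewrite iter_hsigma_eq_omega0.
  rewrite hahnDE // /diff_quotient iterS hsigma_sub_omega0.
  by field; rewrite q1_neq0 subr_eq0 nom.
by apply: cvgMl; apply: cvgB => //; apply: cvgMr.
Qed.

Lemma cvg_hahn_euler_orbit r (f : 'I_r.+1 -> R -> R) x :
  is_interval I -> I om -> I x -> x != om ->
  (forall i, continuous_within_at I (f i) om) ->
  (forall i : 'I_r.+1, hahn_differentiable q w I i (f i)) ->
  hahn_euler f (orb x n) @[n --> \oo] --> hahn_euler f om.
Proof.
move=> Iitv Iom Ix xom fc fd; rewrite /hahn_euler.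
apply: cvg_big => [x0|i _]; [exact: add_continuous|apply: cvgMr].
case: i => -[|i] ir /=.
  exact: cvg_comp (cvg_iter_hsigma_within Iitv Iom Ix) (fc _).
apply: cvg_hahnD_orbit => //.
exact: (fd (Ordinal ir)).
Qed.

End HahnCalculus.

Theorem lemma3p8 (R : realType) (q w : R) (I : set R) (a b : R) (r : nat)
    (f : 'I_r.+1 -> R -> R)
    (q_gt0 : 0 < q) (q_lt1 : q < 1) (w_gt0 : 0 < w)
    (I_itv : is_interval I) (I_omega0 : I (omega0 q w))
    (Ia : I a) (Ib : I b) (ab : a < b)
    (orbits_disjoint : hahn_orbit q w a `&` hahn_orbit q w b = set0)
    (r_gt0 : (0 < r)%N)
    (f_space : forall i, hahn_space q w I a b 1 (f i))
    (integral_eq0 : forall eta : R -> R, hahn_variation q w I a b r eta ->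
       let g := fun t => \sum_(i < r.+1)
         f i t * hahnDn q w I i (eta \o iter (r - i) (hsigma q w)) t in
       hahn_integrable q w a b g /\ hahn_integral q w a b g = 0) :
  forall t, hahn_interval q w a b t ->
    (forall i : 'I_r.+1, hahnDn_defined_at q w I i (f i) t) ->
    \sum_(i < r.+1)
      (-1) ^+ i * (1 / q) ^+ ((i - 1) * i)./2 * hahnDn q w I i (f i) t = 0.
Proof.
have disj m n : iter m (hsigma q w) a <> iter n (hsigma q w) b.
  rewrite !iter_hsigmaE // => e.
  have : (hahn_orbit q w a `&` hahn_orbit q w b) (q ^+ m * a + w * qnum q m).
    by split; [exists m|exists n].
  by rewrite orbits_disjoint.
(* The Euler equation off omega0, from a point mass r steps beyond x_p. *)
have euler_orbit x p : x = a \/ x = b -> x != omega0 q w ->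
    hahn_euler q w I f (iter p (hsigma q w) x) = 0.
  move=> xab xom.
  pose eta (t : R) : R := (t == iter (p + r) (hsigma q w) x)%:R.
  have Ix : I x by case: xab => ->.
  have eta_orbit n : (n < r)%N -> eta (iter n (hsigma q w) x) = 0.
    by move=> nr; rewrite /eta (inj_eq (iter_hsigma_inj _ _ _)) // ltn_eqF ?ltn_addl.
  have var_eta : hahn_variation q w I a b r eta.
    apply: hahn_variation_null_near => //.
    - exact: (within_dnbhs_omega0_proper q_gt0 q_lt1 I_itv I_omega0 Ix xom).
    - by apply: bounded_null_near_pointmass; rewrite iter_hsigma_eq_omega0.
    - move=> j jr; case: xab => e; move: (eta_orbit j jr); rewrite e => ->.
        by split => //; rewrite /eta e; case: eqP => // /esym/disj.
      by split => //; rewrite /eta e; case: eqP => // /disj.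
  have [_] := integral_eq0 eta var_eta.
  have ix := hahn_integral0_pointmass I q_gt0 q_lt1 f p xom.
  have iy y : (forall n, eta (iter n (hsigma q w) y) = 0) ->
    hahn_integral0 q w (hahn_first_variation q w I f eta) y = 0.
    exact: hahn_integral0_first_variation_eq0.
  rewrite -/(hahn_first_variation q w I f eta) /hahn_integral => i0.
  have : hahn_integral0 q w (hahn_first_variation q w I f eta) x = 0.
    case: xab => e; move: i0; rewrite e.
      rewrite (iy b) => [/eqP|n]; first by rewrite sub0r oppr_eq0 => /eqP.
      by rewrite /eta e; case: eqP => // /esym/disj.
    rewrite (iy a) ?subr0 // => n.
    by rewrite /eta e; case: eqP => // /disj.
  rewrite ix => /eqP; rewrite !mulf_eq0 expf_eq0 (gt_eqF q_gt0) andbF /=.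
  rewrite hahn_weightE // mulf_eq0 !subr_eq0 (gt_eqF q_lt1) (negbTE xom) /=.
  exact: eqP.
move=> t tab tdef; change (hahn_euler q w I f t = 0).
have [tE|tom] := eqVneq t (omega0 q w); last first.
  have euler_n x n : x = a \/ x = b -> iter n (hsigma q w) x = t ->
      hahn_euler q w I f t = 0.
    move=> xab e; rewrite -e euler_orbit //.
    by rewrite -(iter_hsigma_eq_omega0 _ q_gt0 q_lt1 n) e.
  case: tab => [[]|tab]; last by rewrite tab eqxx in tom.
  - by move=> [n _]; rewrite -iter_hsigmaE //; apply: euler_n; left.
  - by move=> [n _]; rewrite -iter_hsigmaE //; apply: euler_n; right.
(* As a < b, one of the endpoints has an orbit that approaches omega0. *)
rewrite tE; have [x [xab xom]] : exists x, (x = a \/ x = b) /\ x != omega0 q w.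
  have [aom|aom] := eqVneq a (omega0 q w); last by exists a; split; [left|].
  by exists b; split; [right|rewrite -aom gt_eqF].
have Ix : I x by case: xab => ->.
have fc i : continuous_within_at I (f i) (omega0 q w).
  by have [_ /(_ 0%N isT)[]] := f_space i.
have := cvg_hahn_euler_orbit q_gt0 q_lt1 I_itv I_omega0 Ix xom fc
  (fun i => tdef i tE).
rewrite (_ : (fun n => _) = fun=> 0); last first.
  by apply/funext => n; exact: euler_orbit.
by move=> /(cvg_lim (@Rhausdorff R)) <-; exact: lim_cst.
Qed.
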